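(* The affine semipolar space $\langle Y,\mathcal{G}\rangle$ determined by the semiform $\varrho$ is a $\Gamma$-space, and its every singular subspace carries affine geometry (i.e. with the lines of $\mathcal{G}$ contained in it, it is an affine space).
   Context: Let $F$ be a commutative field with $\mathrm{char}(F)\neq 2$; let $V,V'$ be vector spaces over $F$ with zero vectors $\theta$ and $\mathbf{0}$, $\dim V'<\infty$; let $\eta\colon V\times V\to V'$ be an alternating bilinear map ($\eta(u,u)=\mathbf{0}$ for all $u$) that is nondegenerate (for each $u_1\ne\theta$ there is $u_2$ with $\eta(u_1,u_2)\neq\mathbf{0}$). Let $Y=V'\oplus V$, with vectors written $[v,u]$, $v\in V'$, $u\in V$, and let $\mathfrak{A}$ be the affine space over $Y$ (points are the vectors of $Y$, lines are the cosets of 1-dimensional subspaces). The semiform is $\varrho([v_1,u_1],[v_2,u_2])=\eta(u_1,u_2)-(v_1-v_2)$. Write $p_1\approx p_2$ iff $\varrho(p_1,p_2)=\mathbf{0}$. Let $\mathcal{G}$ be the class of lines $L$ of $\mathfrak{A}$ such that $p_1\approx p_2$ for all $p_1,p_2\in L$ (equivalently, for some pair of distinct points of $L$). The incidence structure $\langle Y,\mathcal{G}\rangle$ is the affine semipolar space determined by $\varrho$. A partial linear space is a $\Gamma$-space if for each point $p$ and line $L$ the point $p$ is collinear with none, exactly one, or all points of $L$. A subspace (a set of points containing each line that meets it in at least two points) is singular if any two of its points are collinear. *)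

(* Defs.v *)
From HB Require Import structures.
From mathcomp Require Import all_boot all_order all_algebra.
From mathcomp Require Import boolp classical_sets functions.

Set Implicit Arguments.
Unset Strict Implicit.
Unset Printing Implicit Defensive.

Import GRing.Theory.
Local Open Scope classical_set_scope.
Local Open Scope ring_scope.

(* A point-line structure on a type T is given by its family of lines
   G : set (set T). *)
Section PointLine.
Variables (T : Type) (G : set (set T)).

(* There may be points on no line (and even no lines at all). *)
Definition partial_linear_space : Prop :=
  (forall L, G L -> exists p q, [/\ L p, L q & p <> q]) /\
  (forall L M p q, G L -> G M -> L p -> L q -> M p -> M q -> p <> q -> L = M).

Definition collinear (p q : T) : Prop := exists2 L, G L & L p /\ L q.

Definition gamma_space : Prop :=
  partial_linear_space /\
  forall p L, G L ->
    [\/ forall q, L q -> ~ collinear p q,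
        exists! q, L q /\ collinear p q
      | forall q, L q -> collinear p q].

Definition line_subspace (S : set T) : Prop :=
  forall L p q, G L -> L p -> L q -> S p -> S q -> p <> q -> L `<=` S.

(* Only distinct points are required to be collinear, so that a singleton is
   singular even when its point lies on no line. *)
Definition singular (S : set T) : Prop :=
  forall p q, S p -> S q -> p <> q -> collinear p q.

Definition lines_in (S : set T) : set (set (set_type S)) :=
  [set M | G (set_val @` M)].

End PointLine.

Arguments lines_in {T} G S.

Definition affine_lines (F : fieldType) (W : lmodType F) : set (set W) :=
  [set L | exists a d : W, d != 0 /\ L = [set a + t *: d | t in [set: F]]].

Arguments affine_lines {F} W.

Definition isomorphic_structures (T U : Type)
    (G : set (set T)) (H : set (set U)) : Prop :=
  exists2 f : T -> U, bijective f & forall L, G L <-> H (f @` L).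

(* The space is over the given field F, of any dimension, possibly 0 or
   infinite.  A structure without points is not an affine space. *)
Definition affine_space (F : fieldType) (T : Type) (G : set (set T)) : Prop :=
  exists W : lmodType F, isomorphic_structures G (affine_lines W).

Section Semiform.
Variables (F : fieldType) (V : lmodType F) (V' : vectType F).
Variable eta : V -> V -> V'.

Definition alternating_map : Prop := forall u, eta u u = 0.

Definition nondegenerate_map : Prop :=
  forall u1, u1 != 0 -> exists u2, eta u1 u2 != 0.

Definition semiform (p1 p2 : V' * V) : V' :=
  eta p1.2 p2.2 - (p1.1 - p2.1).

Definition semipolar_lines : set (set (V' * V)) :=
  [set L | affine_lines (V' * V)%type L /\
           forall p1 p2, L p1 -> L p2 -> semiform p1 p2 = 0].

End Semiform.

(* Main.v *)
(** The relation [p ~ q] given by [semiform eta p q = 0] is reflexive and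
symmetric, and along an affine line the semiform against a fixed point is an
affine function of the parameter; hence it vanishes nowhere, once or everywhere,
which is the Gamma axiom. If two points are related, so are any two points of
the affine line through them, so collinearity of distinct points is [~].
Consequently a singular subspace [S] contains, with two points, their whole
affine line. As 2 is invertible in [F], the sum of two vectors is obtained from
their midpoint by a homothety, so [S] is a coset of a linear subspace, and every
affine line inside [S] belongs to the semipolar space. *)
Require Import Defs.
From HB Require Import structures.
From mathcomp Require Import all_boot all_order all_algebra.
From mathcomp Require Import boolp classical_sets functions.

Set Implicit Arguments.
Unset Strict Implicit.
Unset Printing Implicit Defensive.

Local Open Scope classical_set_scope.
Local Open Scope ring_scope.

Import GRing.Theory.

Section Submodule.
Variables (F : fieldType) (Y : lmodType F) (P : {pred Y}).
Hypothesis P_closed : submod_closed P.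

(* The copy of [P] mentions [P_closed] so that instances can be keyed on it. *)
Definition closed_pred : {pred Y} := let _ := P_closed in P.

HB.instance Definition _ := GRing.isSubmodClosed.Build F Y closed_pred P_closed.

(** [affine_space] asks for a vector space that is a type, so the direction space of a singular
    subspace has to become a type with its own module structure. *)
Record submodule := Submodule {
  submodule_val : Y; submodule_valP : submodule_val \in closed_pred }.

HB.instance Definition _ := [isSub for submodule_val].
HB.instance Definition _ := [Choice of submodule by <:].
HB.instance Definition _ := [SubChoice_isSubLmodule of submodule by <:].

Lemma submodule_valD (x y : submodule) :
  submodule_val (x + y) = submodule_val x + submodule_val y.
Proof. exact: (raddfD (\val : submodule -> Y)). Qed.

Lemma submodule_valZ (t : F) (x : submodule) :
  submodule_val (t *: x) = t *: submodule_val x.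
Proof. exact: (linearZZ (\val : submodule -> Y)). Qed.

Lemma submodule_val_eq0 (x : submodule) : (submodule_val x == 0) = (x == 0).
Proof.
have <- : submodule_val 0 = 0 by exact: (raddf0 (\val : submodule -> Y)).
exact: (inj_eq (val_inj : injective (\val : submodule -> Y))).
Qed.

End Submodule.

Section AffineLines.
Variables (F : fieldType) (Y : lmodType F).
Implicit Types (a d p q : Y) (S L : set Y).

(** The right-hand side no longer mentions [L], which gives uniqueness of the line through two
    points; it also puts any two chosen points at parameters 0 and 1. *)
Lemma affine_line_through L p q : affine_lines Y L -> L p -> L q -> p <> q ->
  L = [set p + t *: (q - p) | t in [set: F]].
Proof.
move=> [a [d [d0 ->]]] [s _ <-] [t _ <-] npq.
have st0 : t - s != 0.
  by rewrite subr_eq0; apply/eqP => ts; apply: npq; rewrite ts.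
have E r : a + s *: d + r *: (a + t *: d - (a + s *: d)) =
           a + (s + r * (t - s)) *: d.
  by rewrite opprD addrACA subrr add0r -scalerBl scalerA -addrA -scalerDl.
apply/seteqP; split=> y [r _ <-] /=; last first.
  by exists (s + r * (t - s)); rewrite ?E.
exists ((r - s) / (t - s)) => //.
by rewrite E divfK // subrKC.
Qed.

Lemma affine_lineI p q : p <> q ->
  affine_lines Y [set p + t *: (q - p) | t in [set: F]].
Proof.
move=> npq; exists p, (q - p); split=> //.
by rewrite subr_eq0; apply/eqP => /esym.
Qed.

Lemma flat_submod S p0 : 2%N \notin [pchar F] -> S p0 ->
  (forall p q t, S p -> S q -> S (p + t *: (q - p))) ->
  submod_closed [pred y | `[< S (p0 + y) >]].
Proof.
move=> char2 Sp0 flat.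
have two0 : (2%:R : F) != 0 by move: char2; rewrite inE /=.
have dirZ t y : S (p0 + y) -> S (p0 + t *: y).
  by move=> Sy; have := flat p0 (p0 + y) t Sp0 Sy; rewrite addrAC subrr add0r.
have dirD x y : S (p0 + x) -> S (p0 + y) -> S (p0 + (x + y)).
  (* Parameter 1/2 yields the midpoint of [p0 + x] and [p0 + y]; [dirZ] then doubles its offset from
     [p0]. *)
  move=> Sx Sy; have := flat _ _ 2%:R^-1 Sx Sy.
  rewrite opprD addrACA subrr add0r -addrA => /(dirZ 2%:R).
  rewrite scalerDr scalerA divff // scale1r scaler_nat mulr2n.
  by rewrite -[x + x + _]addrA subrKC.
split=> [|t x y]; rewrite !inE ?addr0 //.
by move=> Sx Sy; apply: dirD => //; apply: dirZ.
Qed.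

(** The isomorphism is the translation taking [p0] to the origin, from [S] onto its direction
    space. *)
Lemma affine_space_flat S p0 (G : set (set Y)) : 2%N \notin [pchar F] -> S p0 ->
  (forall p q t, S p -> S q -> S (p + t *: (q - p))) ->
  (forall L, L `<=` S -> G L <-> affine_lines Y L) ->
  affine_space F (lines_in G S).
Proof.
move=> char2 Sp0 flat GE.
pose W := submodule (flat_submod char2 Sp0 flat).
have fP (x : set_type S) :
    set_val x - p0 \in closed_pred (flat_submod char2 Sp0 flat).
  by rewrite inE subrKC; exact: set_valP.
have gP (w : W) : p0 + submodule_val w \in S.
  by apply/mem_set; have := submodule_valP w; rewrite inE.
pose f x : W := Submodule (fP x); pose g w : set_type S := SigSub (gP w).
have fK : cancel f g by move=> x; apply: val_inj => /=; rewrite subrKC.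
have gK : cancel g f.
  by move=> w; apply: val_inj => /=; rewrite addrAC subrr add0r.
exists W; exists f; first by exists g.
have valf x : submodule_val (f x) = set_val x - p0 by [].
have LS (L : set (set_type S)) : set_val @` L `<=` S.
  by move=> _ [x _ <-]; exact: set_valP.
move=> L; rewrite /lines_in /= GE //; split.
- move=> [a [d [d0 E]]].
  (* The vectors [a] and [d] live in [Y]; the points at parameters 0 and 1 lift to [S], and their
     images under [f] supply a base point and a direction in [W]. *)
  have [x Lx xa] : (set_val @` L) a.
    by rewrite E; exists 0; rewrite ?scale0r ?addr0.
  have [y Ly yd] : (set_val @` L) (a + d).
    by rewrite E; exists 1; rewrite ?scale1r.
  have dE : set_val y - p0 - (set_val x - p0) = d.
    by rewrite xa yd opprB addrA subrK addrAC subrr add0r.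
  exists (f x), (f y - f x); split; first by rewrite -submodule_val_eq0 /= dE.
  apply/seteqP; split=> [_ [z Lz <-]|_ [t _ <-]] /=.
    have : (set_val @` L) (set_val z) by exists z.
    rewrite E => -[t _ tz]; exists t => //; apply: val_inj => /=.
    by rewrite dE -tz xa addrAC.
  have : (set_val @` L) (a + t *: d) by rewrite E; exists t.
  move=> [z Lz zt]; exists z => //; apply: val_inj => /=.
  by rewrite dE xa zt addrAC.
- move=> [a [d [d0 E]]].
  exists (p0 + submodule_val a), (submodule_val d); split.
    by rewrite submodule_val_eq0.
  apply/seteqP; split=> [_ [z Lz <-]|_ [t _ <-]] /=.
    have : (f @` L) (f z) by exists z.
    rewrite E => -[t _ tz]; exists t => //.
    by rewrite -addrA -submodule_valZ -submodule_valD tz valf subrKC.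
  have : (f @` L) (a + t *: d) by rewrite E; exists t.
  move=> [z Lz zt]; exists z => //.
  by rewrite -addrA -submodule_valZ -submodule_valD -zt valf subrKC.
Qed.

End AffineLines.

Section Semipolar.
Variables (F : fieldType) (V : lmodType F) (V' : vectType F).
Variable eta : {bilinear V -> V -> V'}.
Hypothesis eta_alt : alternating_map eta.
Implicit Types (p q r : V' * V) (L : set (V' * V)).

Lemma alternating_antisym u v : eta u v = - eta v u.
Proof.
apply/eqP; rewrite -addr_eq0; apply/eqP.
have := eta_alt (u + v).
by rewrite linearDl !linearDr /= !eta_alt add0r addr0.
Qed.

Lemma semiformxx p : semiform eta p p = 0.
Proof. by rewrite /semiform eta_alt !subrr. Qed.

Lemma semiformC p q : semiform eta p q = - semiform eta q p.
Proof. by rewrite /semiform alternating_antisym !opprB addrC. Qed.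

Lemma semiform_line r p q t : semiform eta r (p + t *: (q - p)) =
  semiform eta r p + t *: (semiform eta r q - semiform eta r p).
Proof.
rewrite /semiform /= linearDr linearZr linearBr /=.
(* In the difference of two values the constant [r.1] cancels, leaving an expression linear in
   [q - p]. *)
have -> : eta r.2 q.2 - (r.1 - q.1) - (eta r.2 p.2 - (r.1 - p.1)) =
    (eta r.2 q.2 - eta r.2 p.2) + (q.1 - p.1).
  by rewrite (opprD (eta r.2 p.2)) opprK addrACA opprB subrKA.
by rewrite !opprB [p.1 + _ - _]addrAC addrACA -scalerDr.
Qed.

Lemma semiform_on_line p q s t : semiform eta p q = 0 ->
  semiform eta (p + s *: (q - p)) (p + t *: (q - p)) = 0.
Proof.
move=> pq; have qp : semiform eta q p = 0 by rewrite semiformC pq oppr0.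
(* Expanding in the second argument and, by antisymmetry, in the first leaves only values at pairs
   taken from [p] and [q], all zero. *)
rewrite semiform_line ![semiform eta (p + _) _]semiformC !semiform_line.
by rewrite !semiformxx pq qp !(subrr, scaler0, addr0, oppr0).
Qed.

Lemma semipolar_lineI p q : p <> q -> semiform eta p q = 0 ->
  semipolar_lines eta [set p + t *: (q - p) | t in [set: F]].
Proof.
move=> npq pq; split; first exact: affine_lineI.
by move=> _ _ [s _ <-] [t _ <-]; apply: semiform_on_line.
Qed.

Lemma semipolar_collinear p q : p <> q ->
  collinear (semipolar_lines eta) p q <-> semiform eta p q = 0.
Proof.
move=> npq; split=> [[L [_ +] [Lp Lq]]|/(semipolar_lineI npq) GL]; first exact.
exists [set p + t *: (q - p) | t in [set: F]] => //; split.
  by exists 0; rewrite // scale0r addr0.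
by exists 1; rewrite // scale1r subrKC.
Qed.

(** The line [L] through [q] covers the case [p = q], where [collinear] still asks for some line. *)
Lemma collinear_to_line L p q : semipolar_lines eta L -> L q ->
  collinear (semipolar_lines eta) p q <-> semiform eta p q = 0.
Proof.
move=> GL Lq; have [->|/eqP npq] := eqVneq p q; last exact: semipolar_collinear.
by split=> [_|_]; [exact: semiformxx | exists L].
Qed.

Lemma semipolar_gamma_space : gamma_space (semipolar_lines eta).
Proof.
split; first split=> [L [[a [d [d0 ->]]] _]|
                      L M p q [aL _] [aM _] Lp Lq Mp Mq npq].
- exists a, (a + d); split; first by exists 0; rewrite // scale0r addr0.
    by exists 1; rewrite // scale1r.
  by move/eqP; rewrite eq_sym -subr_eq0 addrAC subrr add0r; apply/negP.
- rewrite (affine_line_through aL Lp Lq npq).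
  by rewrite (affine_line_through aM Mp Mq npq).
move=> p L GL; have colE q := @collinear_to_line L p q GL.
have [none|/existsNP[q /not_implyP[Lq /contrapT cpq]]] :=
  pselect (forall q, L q -> ~ collinear (semipolar_lines eta) p q).
  by constructor 1.
have [only|/existsNP[r /not_implyP[[Lr cpr] nqr]]] :=
  pselect (forall r, L r /\ collinear (semipolar_lines eta) p r -> q = r).
  by constructor 2; exists q.
(* The semiform against [p] is affine along [L] and vanishes at the distinct points [q] and [r],
   hence on all of [L]. *)
constructor 3 => x Lx; apply/(colE _ Lx).
move: (Lx); rewrite (affine_line_through GL.1 Lq Lr nqr) => -[t _ <-].
rewrite semiform_line; move/(colE _ Lq): cpq => ->; move/(colE _ Lr): cpr => ->.
by rewrite subrr scaler0 addr0.
Qed.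

Lemma semipolar_singular_affine (S : set (V' * V)) : 2%N \notin [pchar F] ->
  S !=set0 -> line_subspace (semipolar_lines eta) S ->
  singular (semipolar_lines eta) S ->
  affine_space F (lines_in (semipolar_lines eta) S).
Proof.
move=> char2 [p0 Sp0] subS singS.
have perpS p q : S p -> S q -> semiform eta p q = 0.
  have [-> *|/eqP npq Sp Sq] := eqVneq p q; first exact: semiformxx.
  by apply/(semipolar_collinear npq)/singS.
apply: (affine_space_flat char2 Sp0) => [p q t Sp Sq|L LS].
  have [->|/eqP npq] := eqVneq q p; first by rewrite subrr scaler0 addr0.
  have nqp : p <> q by move=> /esym.
  apply: (subS _ p q (semipolar_lineI nqp (perpS _ _ Sp Sq))) => //.
  - by exists 0; rewrite // scale0r addr0.
  - by exists 1; rewrite // scale1r subrKC.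
(* An affine line inside [S] is a semipolar line because the semiform vanishes on all pairs of
   points of [S]. *)
by split=> [[]//|aL]; split=> // p q /LS Sp /LS Sq; apply: perpS.
Qed.

End Semipolar.

Theorem theorem2p17 (F : fieldType) (V : lmodType F) (V' : vectType F)
    (eta : {bilinear V -> V -> V'})
    (char_neq2 : 2%N \notin [pchar F])
    (eta_alt : alternating_map eta)
    (eta_nondeg : nondegenerate_map eta) :
  gamma_space (semipolar_lines eta) /\
  (forall S : set (V' * V), S !=set0 ->
     line_subspace (semipolar_lines eta) S ->
     singular (semipolar_lines eta) S ->
     affine_space F (lines_in (semipolar_lines eta) S)).
Proof.
split; first exact: semipolar_gamma_space.
by move=> S; apply: semipolar_singular_affine.
Qed.
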